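(* Let $(X,d_X)$ be a compact metric space, $k\ge2$, and let $T:\mathbb{Z}_+^k\to C^0(X,X)$ be a continuous $\mathbb{Z}_+^k$-action with generators $\{T_i:1\le i\le k\}$. Let $\Sigma_k=\prod_{n\in\mathbb{Z}_+}\{1,\dots,k\}$ with the product topology (each factor discrete), let $Y=\Sigma_k\times X$ with the product topology, and let $\tilde\sigma:Y\to Y$ be the skew product $$\tilde\sigma\bigl(\{i_n\}_{n\in\mathbb{Z}_+},x\bigr)=\bigl(\{i_{n+1}\}_{n\in\mathbb{Z}_+},\,T_{i_0}x\bigr).$$ Then $\tilde\sigma$ is an extension of $\sigma_T:X_T\to X_T$ (that is, there is a continuous surjection $\pi:Y\to X_T$ with $\pi\circ\tilde\sigma=\sigma_T\circ\pi$), and hence $$h(T)=h(\sigma_T)\le h(\tilde\sigma).$$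
   Context: $\mathbb{Z}_+=\{0,1,2,\dots\}$. $C^0(X,X)$ is the set of continuous maps $X\to X$. A continuous $\mathbb{Z}_+^k$-action on $X$ is a monoid homomorphism $T:\mathbb{Z}_+^k\to C^0(X,X)$; its generators are the (commuting) maps $T_i=T(0,\dots,0,1,0,\dots,0)$ with $1$ in the $i$-th place, $1\le i\le k$. The orbit space of $T$ is $$X_T=\Bigl\{\{x_n\}_{n\in\mathbb{Z}_+}\in\prod_{n\in\mathbb{Z}_+}X:\ \text{for every } n\in\mathbb{Z}_+ \text{ there is } i_n\in\{1,\dots,k\} \text{ with } T_{i_n}(x_n)=x_{n+1}\Bigr\},$$ a compact space with metric $d_{X_T}(\bar x,\bar y)=\sum_{n=0}^\infty 2^{-n}d_X(x_n,y_n)$. The shift $\sigma_T:X_T\to X_T$ is $\sigma_T(\{x_n\}_n)=\{x_{n+1}\}_n$. The (Friedland) entropy of the action is by definition $h(T):=h(\sigma_T)$. For a continuous map $f$ of a compact metric space $(Z,d)$, the topological entropy is $h(f)=\lim_{\varepsilon\to0}\limsup_{n\to\infty}\frac1n\log s(f,n,\varepsilon)$, where $s(f,n,\varepsilon)$ is the largest cardinality of a set $F\subset Z$ such that $\max_{0\le i\le n-1}d(f^i x,f^i y)>\varepsilon$ for all distinct $x,y\in F$; it does not depend on the choice of metric $d$ compatible with the topology. *)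

(* Defs.v *)
From HB Require Import structures.
From mathcomp Require Import all_boot all_order all_algebra finmap.
From mathcomp Require Import all_classical all_reals all_analysis.

Set Implicit Arguments.
Unset Strict Implicit.
Unset Printing Implicit Defensive.

Import Order.TTheory GRing.Theory Num.Theory.
Import numFieldNormedType.Exports.

Local Open Scope classical_set_scope.
Local Open Scope ring_scope.

Record compatible_metric (R : realType) (Z : topologicalType)
    (d : Z -> Z -> R) : Prop := CompatibleMetric {
  cmetricxx : forall x, d x x = 0;
  cmetric_positivity : forall x y, d x y = 0 -> x = y;
  cmetric_sym : forall x y, d x y = d y x;
  cmetric_triangle : forall y x z, d x z <= d x y + d y z;
  cmetric_nbhs : forall (x : Z) (A : set Z),
    nbhs x A <-> exists2 e : R, 0 < e & [set y | d x y < e] `<=` A }.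

(* For n = 0 the maximum is over the empty family and equals 0. *)
Definition bowen_dist (R : realType) (Z : Type) (d : Z -> Z -> R)
    (f : Z -> Z) (n : nat) (x y : Z) : R :=
  \big[Num.max/0]_(i < n) d (iter i f x) (iter i f y).

Definition eps_separated (R : realType) (Z : choiceType) (d : Z -> Z -> R)
    (f : Z -> Z) (n : nat) (e : R) (F : {fset Z}) : Prop :=
  forall x y, x \in F -> y \in F -> x <> y -> e < bowen_dist d f n x y.

(* The supremum is a maximum on a compact space with a continuous f; an
   infinite eps_separated set would make it +oo. *)
Definition separated_card (R : realType) (Z : choiceType) (d : Z -> Z -> R)
    (f : Z -> Z) (n : nat) (e : R) : \bar R :=
  ereal_sup [set (#|` F|)%fset%:R%:E | F in eps_separated d f n e].

(* The metric is explicit. On a compact space the value is the same for all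
   metrics compatible with the topology. *)
Definition topological_entropy (R : realType) (Z : choiceType)
    (d : Z -> Z -> R) (f : Z -> Z) : \bar R :=
  lim ((limn_esup (fun n : nat =>
          (n%:R^-1)%:E * lne (separated_card d f n e))%E) @[e --> 0^'+]).

Definition extension_of (Y Z : topologicalType) (g : Y -> Y) (f : Z -> Z) :
    Prop :=
  exists pi : Y -> Z,
    [/\ continuous pi, set_surj [set: Y] [set: Z] pi & pi \o g = f \o pi].

(* The additive monoid Z_+^k is 'rV[nat]_k, its i-th unit vector is
   delta_mx 0 i, and the indices 1, ..., k are the elements of 'I_k. *)
Record continuous_action (k : nat) (X : topologicalType) := ContinuousAction {
  action_map :> 'rV[nat]_k -> X -> X;
  action_continuous : forall m, continuous (action_map m);
  action0 : action_map 0 = id;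
  actionD : forall m n, action_map (m + n) = action_map m \o action_map n }.

Definition generator (k : nat) (X : topologicalType)
    (T : continuous_action k X) (i : 'I_k) : X -> X :=
  T (delta_mx 0 i).

(* {ptws nat -> X} carries the product topology, and the coercion of a set to
   a type carries the subspace topology. *)
Definition orbit_space (k : nat) (X : topologicalType)
    (T : continuous_action k X) : set {ptws nat -> X} :=
  [set x | forall n, exists i : 'I_k, generator T i (x n) = x n.+1].

Lemma orbit_shift_subproof (k : nat) (X : topologicalType)
    (T : continuous_action k X) (x : orbit_space T) :
  (fun n => set_val x n.+1) \in orbit_space T.
Proof. by apply/mem_set => n; exact: (set_mem (valP x)). Qed.

Definition orbit_shift (k : nat) (X : topologicalType)
    (T : continuous_action k X) (x : orbit_space T) : orbit_space T :=
  exist (fun y => y \in orbit_space T) _ (orbit_shift_subproof x).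
Arguments orbit_shift {k X} T.

Definition orbit_dist (R : realType) (k : nat) (X : metricType R)
    (T : continuous_action k X) (x y : orbit_space T) : R :=
  limn (series (fun n : nat => 2 ^- n * mdist (set_val x n) (set_val y n))).
Arguments orbit_dist {R k X} T.

Definition friedland_entropy (R : realType) (k : nat) (X : metricType R)
    (T : continuous_action k X) : \bar R :=
  topological_entropy (orbit_dist T) (orbit_shift T).

Definition full_shift_space (k : nat) : topologicalType :=
  {ptws nat -> discrete_topology 'I_k}.

Definition skew_product (k : nat) (X : topologicalType)
    (T : continuous_action k X) (y : full_shift_space k * X) :
    full_shift_space k * X :=
  (fun n => y.1 n.+1, generator T (y.1 0%N) y.2).

(* Main.v *)
(** The factor map sends ((i_n), x) to the sequence of X-coordinates of its
    iterates under the skew product; it is onto because an orbit together with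
    a choice of the indices i_n determines a preimage. As the skew product space
    is compact, this map is uniformly continuous from any compatible metric to
    the orbit metric, so a section of it carries e-separated sets for the shift
    to e'-separated sets of the same cardinality for the skew product. *)

Require Import Defs.
From mathcomp Require Import all_boot all_order all_algebra.
From mathcomp Require Import all_classical all_reals all_analysis.
From mathcomp Require Import finmap lra.

Import Order.TTheory GRing.Theory Num.Theory.
Import numFieldNormedType.Exports.

Local Open Scope classical_set_scope.
Local Open Scope ereal_scope.

(** * Entropy as a supremum over scales *)

Lemma le_limn_esup (R : realType) (u v : nat -> \bar R) :
  (forall n, u n <= v n) -> limn_esup u <= limn_esup v.
Proof.
move=> uv; rewrite !limn_esup_lim.
apply: lee_lim; [exact: is_cvg_esups|exact: is_cvg_esups|apply: nearW => n].
apply: ge_ereal_sup => _ /= [m nm <-].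
by apply: (le_trans (uv m)); apply: ereal_sup_ubound; exists m.
Qed.

Lemma le_lne (R : realType) (x y : \bar R) : 0 <= x -> x <= y -> lne x <= lne y.
Proof.
move=> x0 xy; rewrite lee_lne// in_itv/= ?x0 leey//.
by rewrite (le_trans x0 xy).
Qed.

Section entropy.
Variables (R : realType) (Z : choiceType) (d : Z -> Z -> R) (f : Z -> Z).

(** The maximum has default value 0, also its value for [n = 0]; with [0 <= e] the default never
    exceeds [e], so some time [i] must witness the separation. *)
Lemma lt_bowen_distP n x y (e : R) : (0 <= e)%R ->
  (e < bowen_dist d f n x y)%R <->
  exists2 i, (i < n)%N & (e < d (iter i f x) (iter i f y))%R.
Proof.
move=> e0; split=> [|[i ni ei]].
  rewrite ltNge => /negP ne; apply: contrapT => h; apply: ne.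
  apply/bigmax_leP; split=> // i _; rewrite leNgt; apply/negP => ei.
  by apply: h; exists i.
by apply: (lt_le_trans ei); exact: (le_bigmax _ _ (Ordinal ni)).
Qed.

(** The empty set is vacuously separated; this provides the sign condition of [le_lne]. *)
Lemma separated_card_ge0 n (e : R) : 0 <= separated_card d f n e.
Proof. by apply: ereal_sup_ubound; exists fset0; rewrite ?cardfs0. Qed.

Definition separated_growth (e : R) : \bar R :=
  limn_esup (fun n => (n%:R^-1)%:E * lne (separated_card d f n e)).

(** A smaller scale admits more separated sets, so the growth rate is nonincreasing in [e] and its
    right limit at 0 is a supremum. Entropies can then be compared one scale at a time. *)
Lemma topological_entropyE :
  topological_entropy d f = ereal_sup (separated_growth @` `]0%R, +oo[).
Proof.
apply: cvg_lim => //; apply: nonincreasing_at_right_cvge => // x y _ _ xy.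
apply: le_limn_esup => n; rewrite lee_wpmul2l// ?lee_fin ?invr_ge0//.
apply: le_lne; first exact: separated_card_ge0.
apply: ereal_sup_le => _ [F sF <-]; exists F => // a b aF bF ab.
exact: le_lt_trans xy (sF a b aF bF ab).
Qed.

End entropy.

(** * Entropy of a factor *)

Section factor.
Variables (R : realType) (Y Z : choiceType).
Variables (dY : Y -> Y -> R) (dZ : Z -> Z -> R) (g : Y -> Y) (f : Z -> Z).
Variable pi : Y -> Z.
Hypothesis pig : pi \o g = f \o pi.
Hypothesis pi_surj : set_surj [set: Y] [set: Z] pi.

Lemma factor_iter n y : pi (iter n g y) = iter n f (pi y).
Proof. by elim: n => //= n <-; exact: (congr1 (@^~ (iter n g y)) pig). Qed.

Lemma separated_card_factor n (e e' : R) : (0 <= e)%R -> (0 <= e')%R ->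
  (forall y y', dY y y' <= e' -> dZ (pi y) (pi y') <= e)%R ->
  separated_card dZ f n e <= separated_card dY g n e'.
Proof.
move=> e0 e'0 pi_e.
have /choice[s sK] : forall z, exists y, pi y = z.
  by move=> z; have [y _ <-] := pi_surj z I; exists y.
apply: ereal_sup_le => _ [F sF <-]; exists [fset s z | z in F]%fset; last first.
  by rewrite card_imfset//; exact: can_inj sK.
move=> _ _ /imfsetP[z /= zF ->] /imfsetP[z' /= z'F ->] zz'.
have /(sF _ _ zF z'F)/(lt_bowen_distP _ _ _ _ _ _ _ _ e0)[i ni ei] : z <> z'.
  by move=> h; apply: zz'; rewrite h.
(* The same time [i] works: lifts within [e'] at time [i] would have images within [e], and these
   images are the [i]-th iterates of [z] and [z']. *)
apply/lt_bowen_distP => //; exists i => //; rewrite ltNge; apply/negP => /pi_e.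
by rewrite !factor_iter !sK leNgt ei.
Qed.

Lemma topological_entropy_factor :
  (forall e : R, 0 < e -> exists2 e' : R, 0 < e' &
    forall y y', dY y y' <= e' -> dZ (pi y) (pi y') <= e)%R ->
  topological_entropy dZ f <= topological_entropy dY g.
Proof.
move=> pi_unif; rewrite !topological_entropyE.
apply: ge_ereal_sup => _ [e /= + <-]; rewrite in_itv/= andbT => e0.
have [e' e'0 pi_e] := pi_unif e e0.
apply: (@le_trans _ _ (separated_growth _ _ dY g e')).
  apply: le_limn_esup => n; rewrite lee_wpmul2l// ?lee_fin ?invr_ge0//.
  apply: le_lne; first exact: separated_card_ge0.
  by apply: separated_card_factor => //; exact: ltW.
by apply: ereal_sup_ubound; exists e' => //=; rewrite in_itv/= e'0.
Qed.

End factor.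

Local Open Scope ring_scope.

(** * Compactness: bounded diameter and uniform continuity *)

Lemma ptws_continuous (Z V : topologicalType) (I : Type)
    (f : Z -> {ptws I -> V}) :
  (forall i, continuous (fun z => f z i)) -> continuous f.
Proof.
move=> cf z; apply/cvg_sup => i.
exact: (@continuous_comp_initial _ _ _ (@^~ i) f (cf i)).
Qed.

Lemma compact_mdist_bounded (R : realType) (X : metricType R) :
  compact [set: X] -> exists M : R, forall x y : X, mdist x y <= M.
Proof.
move=> cX; have [[x0]|/forallNP X0] := pselect (exists x : X, True); last first.
  by exists 0 => x; case: (X0 x).
move/compact_near_coveringP : cX.
(* The near-covering form of compactness, with the candidate bound tending to infinity as parameter,
   replaces the extraction of a finite subcover. *)
move=> /(_ R (pinfty_nbhs R) (fun M x => mdist x0 x <= M) _).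
case=> [x _|M [_ hM]].
  exists (ball x 1, [set M | mdist x0 x + 1 < M]) => /=.
    split; first exact: nbhsx_ballx.
    by exists (mdist x0 x + 1); split => //; exact: num_real.
  case=> y M [] /=; rewrite ballEmdist /= => xy /ltW; apply: le_trans.
  by rewrite (le_trans (metric_triangle _ x _))// lerD2l ltW.
have /= h : [set: X] `<=` (fun x => mdist x0 x <= M + 1).
  by apply: hM; rewrite ltrDl.
(* Any two points are compared through the base point [x0]. *)
exists ((M + 1) + (M + 1)) => x y; rewrite (le_trans (metric_triangle _ x0 _))//.
by rewrite metric_sym lerD// h.
Qed.

(** Heine-Cantor for bare distance functions, by a near covering whose parameter is the radius
    tending to 0 from the right. *)
Lemma compact_uniform (R : realType) (Y : topologicalType) (Z : Type)
    (dY : Y -> Y -> R) (dZ : Z -> Z -> R) (pi : Y -> Z) :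
  compact [set: Y] -> compatible_metric dY ->
  (forall x y, dZ x y = dZ y x) ->
  (forall y x z, dZ x z <= dZ x y + dZ y z) ->
  (forall y (e : R), 0 < e -> \forall y' \near y, dZ (pi y) (pi y') < e) ->
  forall e : R, 0 < e -> exists2 e' : R, 0 < e' &
    forall y y', dY y y' <= e' -> dZ (pi y) (pi y') <= e.
Proof.
move=> cY [_ _ _ dYtri dYnbhs] dZsym dZtri pi_cont e e0.
move/compact_near_coveringP : cY.
move=> /(_ R (0^'+) (fun r y => forall y', dY y y' <= r ->
  dZ (pi y) (pi y') <= e) _).
case=> [y _|r /= r0 hr].
  have e20 : 0 < e / 2 by rewrite divr_gt0.
  have /dYnbhs[r r0 hr] := pi_cont y (e / 2) e20.
  have r20 : 0 < r / 2 by rewrite divr_gt0.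
  (* With [y1] within [r / 2] of [y] and [y2] within [r / 2] of [y1], both lie within [r] of [y], so
     both images are within [e / 2] of [pi y]. *)
  exists ([set y' | dY y y' < r / 2], [set s | s < r / 2]) => /=.
    split; first by apply/dYnbhs; exists (r / 2).
    exact: nbhs_right_lt.
  case=> y1 s [] /= yy1 sr y2 y12.
  rewrite (le_trans (dZtri (pi y) _ _))// (splitr e) lerD//.
    rewrite dZsym ltW//; apply: (hr y1) => /=; apply: lt_trans yy1 _.
    by rewrite ltr_pdivrMr// ltr_pMr// ltr1n.
  apply/ltW/(hr y2); rewrite /= (le_lt_trans (dYtri y1 _ _))// (splitr r).
  by rewrite ltrD// (le_lt_trans y12).
(* The covering argument handles only radii strictly between 0 and [r]. *)
have h2 : r / 2 < r by rewrite ltr_pdivrMr// ltr_pMr// ltr1n.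
exists (r / 2); first by rewrite divr_gt0.
move=> y y' yy'; apply: (hr (r / 2)) yy' => //=.
  by rewrite sub0r normrN gtr0_norm ?divr_gt0.
by rewrite divr_gt0.
Qed.

(** * Series with geometric weights *)

Section weighted_series.
Variable R : realType.
Implicit Types (u : nat -> R) (M h : R).

Let S u m := series (fun n => 2 ^- n * u n) m.

Lemma weighted_seriesS u m : S u m.+1 = u 0%N + S (fun n => u n.+1) m / 2.
Proof.
rewrite /S /series/= big_nat_recl// expr0 invr1 mul1r; congr (_ + _).
rewrite mulr_suml; apply: eq_bigr => i _.
by rewrite exprS invfM -mulrA mulrC.
Qed.

(** The first [N] weights sum to at most 2, and the remaining ones to at most [2 / 2 ^+ N]. The
    induction on [N] peels off the first term and applies the hypothesis to the shifted sequence,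
    whence the generality in [u]. *)
Lemma weighted_series_le u M h N m : 0 <= M -> 0 <= h ->
  (forall n, u n <= M) -> (forall n, (n < N)%N -> u n <= h) ->
  S u m <= 2 * h + 2 * M / 2 ^+ N.
Proof.
move=> M0 h0; elim: N u m => [|N IH] u m uM uh.
  rewrite expr0 divr1; apply: (@le_trans _ _ (2 * M)); last first.
    by rewrite lerDr mulr_ge0.
  elim: m u uM {uh} => [|m IH] u uM.
    by rewrite /S /series/= big_geq// mulr_ge0.
  rewrite weighted_seriesS; have := IH (fun n => u n.+1) (fun n => uM n.+1).
  by have := uM 0%N; lra.
case: m => [|m].
  by rewrite /S /series/= big_geq// addr_ge0// ?divr_ge0 ?mulr_ge0 ?exprn_ge0.
rewrite weighted_seriesS exprS invfM.
have := IH (fun n => u n.+1) m (fun n => uM n.+1) (fun n nN => uh n.+1 nN).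
by have := uh 0%N isT; lra.
Qed.

Lemma weighted_series_cvg u M : (forall n, 0 <= u n) ->
  (forall n, u n <= M) -> cvgn (S u).
Proof.
move=> u0 uM; apply: nondecreasing_is_cvgn.
  apply/nondecreasing_seqP => n; rewrite /S seriesSr lerDl.
  by rewrite mulr_ge0// invr_ge0 exprn_ge0.
exists (2 * M) => _ [n _ <-].
have M0 : 0 <= M := le_trans (u0 0%N) (uM 0%N).
(* For [N = 0] the condition on the first terms is vacuous and the bound is [2 * M]. *)
have := weighted_series_le u M 0 0 n M0 (lexx 0) uM.
by rewrite expr0 divr1 mulr0 add0r; apply.
Qed.

End weighted_series.

(** * The orbit metric *)

Section orbit_space.
Variables (R : realType) (X : metricType R) (k : nat).
Variable T : continuous_action k X.
Hypothesis cX : compact [set: X].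

Lemma orbit_dist_cvg (x y : orbit_space T) :
  cvgn (series (fun n => 2 ^- n * mdist (set_val x n) (set_val y n))).
Proof.
have [M hM] := compact_mdist_bounded _ _ cX.
by apply: weighted_series_cvg => n; [exact: mdist_ge0|exact: hM].
Qed.

Lemma orbit_dist_sym (x y : orbit_space T) : orbit_dist T x y = orbit_dist T y x.
Proof.
rewrite /orbit_dist; congr (limn (series _)); apply/funext => n.
by rewrite metric_sym.
Qed.

Lemma orbit_dist_triangle (y x z : orbit_space T) :
  orbit_dist T x z <= orbit_dist T x y + orbit_dist T y z.
Proof.
rewrite /orbit_dist -limD; [|exact: orbit_dist_cvg..].
apply: ler_lim; first exact: orbit_dist_cvg.
  by apply: is_cvgD; exact: orbit_dist_cvg.
apply: nearW => n; rewrite /series/= fctE -big_split/=; apply: ler_sum => i _.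
by rewrite -mulrDr ler_pM2l ?invr_gt0 ?exprn_gt0// metric_triangle.
Qed.

(** Finitely many coordinates control the orbit metric up to a small tail. Only this direction of
    the comparison with the product topology is needed to transfer continuity of [pi]. *)
Lemma orbit_dist_near (Y : topologicalType) (pi : Y -> orbit_space T) :
  continuous pi -> forall y (e : R), 0 < e ->
  \forall y' \near y, orbit_dist T (pi y) (pi y') < e.
Proof.
move=> cpi y e e0; have [M hM] := compact_mdist_bounded _ _ cX.
have M0 : 0 <= M := le_trans (mdist_ge0 _ _) (hM (set_val (pi y) 0%N) (set_val (pi y) 0%N)).
(* The tail from [N] on takes less than half of [e]; the first [N] coordinates, each within [e / 4],
   take at most [2 * (e / 4)], the other half. *)
have [N hN] : exists N : nat, 2 * M / 2 ^+ N < e / 2.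
  have /cvgrPdist_lt/(_ (e / 2)) : (2 * M) * 2^-1 ^+ n @[n --> \oo] --> (0 : R).
    rewrite -(mulr0 (2 * M)); apply: cvgMl_tmp; apply: cvg_expr.
    by rewrite ger0_norm// invf_lt1// ltr1n.
  rewrite divr_gt0// => /(_ isT)[N _ /(_ N (leqnn N))/=].
  rewrite sub0r normrN => h; exists N; rewrite -exprVn.
  exact: le_lt_trans (ler_norm _) h.
have coord n : \forall y' \near y,
    mdist (set_val (pi y) n) (set_val (pi y') n) <= e / 2 / 2.
  have : continuous (fun y => set_val (pi y) n).
    move=> z; apply: (@continuous_comp _ _ _ (set_val \o pi) (@^~ n)).
      by apply: continuous_comp; [exact: cpi|exact: initial_continuous].
    exact: proj_continuous.
  by move=> /(_ y)/metricType_numDomainType.cvgr_dist_le; apply; rewrite !divr_gt0.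
have : \forall y' \near y, forall n : 'I_N,
    mdist (set_val (pi y) n) (set_val (pi y') n) <= e / 2 / 2.
  by apply: filter_forall => n; exact: coord.
apply: filterS => y' hy'.
apply: (@le_lt_trans _ _ (2 * (e / 2 / 2) + 2 * M / 2 ^+ N)); last first.
  by rewrite [ltRHS]splitr mulrC divfK// ltrD2l.
apply: limr_le; first exact: orbit_dist_cvg.
apply: nearW => m; apply: weighted_series_le => // [|n nN].
  by rewrite !divr_ge0// ltW.
exact: (hy' (Ordinal nN)).
Qed.

End orbit_space.

(** * The skew product and its factor map *)

Lemma continuous_pair (Z U V : topologicalType) (f : Z -> U) (g : Z -> V) :
  continuous f -> continuous g -> continuous (fun z => (f z, g z)).
Proof. by move=> cf cg z; apply: cvg_pair; [exact: cf|exact: cg]. Qed.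

Section skew_product.
Variables (X : topologicalType) (k : nat).
Variable T : continuous_action k X.

Let Y := (full_shift_space k * X)%type.

Lemma full_shift_coord_continuous n :
  continuous (fun y : Y => y.1 n : discrete_topology 'I_k).
Proof.
move=> y; apply: (@continuous_comp Y (full_shift_space k) _ fst (@^~ n)).
  exact: cvg_fst.
exact: (@proj_continuous nat (fun=> discrete_topology 'I_k) n).
Qed.

Lemma skew_product_shift_continuous :
  continuous (fun y : Y => (fun n => y.1 n.+1) : full_shift_space k).
Proof.
apply: (@ptws_continuous Y (discrete_topology 'I_k) nat) => n.
exact: full_shift_coord_continuous.
Qed.

(** The symbol at position 0 is locally constant, so near [y] the map agrees with a single
    continuous generator. *)
Lemma skew_product_generator_continuous :
  continuous (fun y : Y => generator T (y.1 0%N) y.2).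
Proof.
move=> y; have y0 : \forall z \near y, z.1 0%N = y.1 0%N.
  apply: (full_shift_coord_continuous 0 y [set y.1 0%N]).
  exact: (@discrete_set1 (discrete_topology 'I_k)).
have gen_y : {for y, continuous (fun z : Y => generator T (y.1 0%N) z.2)}.
  apply: (@continuous_comp Y X _ snd); first exact: cvg_snd.
  exact: action_continuous.
move=> P /gen_y. apply: filterS2 y0 => z /= ->. exact.
Qed.

Lemma skew_product_continuous : continuous (skew_product T).
Proof.
exact: continuous_pair skew_product_shift_continuous
  skew_product_generator_continuous.
Qed.

Lemma skew_iter_in_orbit_space (y : Y) :
  (fun n => (iter n (skew_product T) y).2) \in orbit_space T.
Proof.
(* The generator applied at time [n] is named by the leading symbol of the [n]-th iterate. *)
by apply/mem_set => n; exists ((iter n (skew_product T) y).1 0%N).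
Qed.

Definition skew_orbit (y : Y) : orbit_space T :=
  exist (fun x => x \in orbit_space T) _ (skew_iter_in_orbit_space y).

(** The orbit space has the initial topology of its inclusion in a product, so continuity is checked
    on each coordinate, an iterate of the skew product followed by a projection. *)
Lemma skew_orbit_continuous : continuous skew_orbit.
Proof.
apply: continuous_comp_initial; apply: ptws_continuous => n y.
apply: (@continuous_comp _ _ _ (iter n (skew_product T)) snd); last exact: cvg_snd.
move: y; elim: n => [|n IH] y /=; first exact: cvg_id.
by apply: continuous_comp; [exact: IH|exact: skew_product_continuous].
Qed.

Lemma skew_orbit_surj : set_surj [set: Y] [set: orbit_space T] skew_orbit.
Proof.
move=> z _; have [i iz] := choice (set_mem (valP z)).
exists ((i : full_shift_space k), set_val z 0%N) => //.
apply: val_inj; apply/funext => n /=.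
(* The induction must also track the symbols: after [n] steps the index sequence has been shifted by
   [n]. *)
suff -> : iter n (skew_product T) ((i : full_shift_space k), set_val z 0%N) =
    ((fun m => i (n + m)%N) : full_shift_space k, set_val z n) by [].
elim: n => //= n ->; rewrite /skew_product/=; congr (_, _).
  by apply/funext => m; rewrite addnS.
by rewrite addn0; exact: iz.
Qed.

Lemma skew_orbit_shift : skew_orbit \o skew_product T = orbit_shift T \o skew_orbit.
Proof.
by apply/funext => y; apply: val_inj; apply/funext => n /=; rewrite -iterSr.
Qed.

(** Tychonoff for finite discrete factors, then a product of two compact sets. *)
Lemma skew_space_compact : compact [set: X] -> compact [set: Y].
Proof.
move=> cX; rewrite -setXTT; apply: compact_setX cX.
have c (n : nat) : compact [set: discrete_topology 'I_k].
  exact: (@finite_compact (discrete_topology 'I_k) _ finite_finset).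
have := @tychonoff nat (fun=> discrete_topology 'I_k) (fun=> setT) c.
by congr (compact _); apply/seteqP.
Qed.

End skew_product.

Local Open Scope ereal_scope.

Theorem proposition2p5 (R : realType) (X : metricType R) (k : nat)
    (T : continuous_action k X) :
  compact [set: X] -> (2 <= k)%N ->
  [/\ extension_of (skew_product T) (orbit_shift T),
      friedland_entropy T =
        topological_entropy (orbit_dist T) (orbit_shift T) &
      forall dY : full_shift_space k * X -> full_shift_space k * X -> R,
        compatible_metric dY ->
        topological_entropy (orbit_dist T) (orbit_shift T) <=
          topological_entropy dY (skew_product T)].
Proof.
(* The equality in the middle holds by definition of [friedland_entropy]. *)
move=> cX _; split=> // [|dY dYY].
  exists (skew_orbit _ _ T); split; [exact: skew_orbit_continuous|
    exact: skew_orbit_surj|exact: skew_orbit_shift].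
apply: topological_entropy_factor (skew_orbit_shift _ _ T) (skew_orbit_surj _ _ T) _.
apply: compact_uniform => //; [exact: skew_space_compact|exact: orbit_dist_sym|
  exact: orbit_dist_triangle|].
by apply: orbit_dist_near => //; exact: skew_orbit_continuous.
Qed.
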